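(* Let $X$ be a non-locally-compact abelian Polish group and let $A\subseteq X$ be an analytic Haar-null set. Then there exists a continuous Borel probability measure $M$ on $P(X)$ such that: (i) $M(T(A))=1$. (ii) If $B\subseteq X$ is any other analytic Haar-null set, then either $M(T(B))=1$ or $M(T(B))=0$.
   Context: $P(X)$ denotes the space of all Borel probability measures on $X$, equipped with the weak topology (convergence against bounded continuous real functions), which makes it a Polish space. A universally measurable set $A\subseteq X$ is called Haar-null if there exists $\mu\in P(X)$ such that $\mu(x+A)=0$ for every $x\in X$ (measures are extended to universally measurable sets via completion). For a universally measurable set $A\subseteq X$ put $T(A)=\{\mu\in P(X):\mu(x+A)=0 \text{ for every } x\in X\}$. For $A$ analytic, $T(A)$ is a co-analytic, hence universally measurable, subset of $P(X)$, so $M(T(A))$ is understood via the completion of $M$. A Borel probability measure is continuous if it vanishes on every singleton. *)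

(* Defs.v *)
From HB Require Import structures.
From mathcomp Require Import all_boot all_order all_algebra.
From mathcomp Require Import all_classical all_reals all_analysis.
From mathcomp Require Import measurable_realfun.

Set Implicit Arguments.
Unset Strict Implicit.
Unset Printing Implicit Defensive.

Import Order.TTheory GRing.Theory Num.Theory.
Import numFieldNormedType.Exports.

Local Open Scope classical_set_scope.
Local Open Scope ring_scope.

(* Needed because the measurable types of the library are pointed. *)
HB.instance Definition _ (X : topologicalZmodType) := isPointed.Build X 0.

Section polish.
Context (R : realType).

Definition separable (T : topologicalType) : Prop :=
  exists2 D : set T, countable D & dense D.

Definition completely_metrizable (T : topologicalType) : Prop :=
  exists (M : metricType R) (f : T -> M) (g : M -> T),
    [/\ cancel f g, cancel g f, continuous f, continuous g &
        forall F : set_system M, ProperFilter F -> cauchy F -> exists x : M, F --> x].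

Definition polish (T : topologicalType) : Prop :=
  separable T /\ completely_metrizable T.

(* The empty set is analytic, as the image of the empty space. *)
Definition analytic (T : topologicalType) (A : set T) : Prop :=
  exists (P : topologicalType) (f : P -> T),
    [/\ polish P, continuous f & range f = A].

End polish.

Definition borel (T : ptopologicalType) := g_sigma_algebraType (@open T).

HB.instance Definition _ (T : ptopologicalType) := Measurable.on (borel T).

Section borel_probability.
Context (R : realType) (T : ptopologicalType).

(* An element of [probability (borel T) R] is a function on all sets whose    *)
(* values off the Borel sets are unconstrained; fixing those values to 0      *)
(* makes equality coincide with equality on Borel sets.                       *)
Record borel_probability := BorelProbability {
  bprob :> probability (borel T) R ;
  bprob_nonmeasurable : forall B : set (borel T), ~ measurable B -> bprob B = 0%E
}.

HB.instance Definition _ := gen_eqMixin borel_probability.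
HB.instance Definition _ := gen_choiceMixin borel_probability.

Lemma borel_probability_ext (mu nu : borel_probability) :
  (forall B : set (borel T), measurable B -> mu B = nu B) -> mu = nu.
Proof.
case: mu nu => mu mu0 [nu nu0] /= munu.
have {}munu : mu = nu :> (set (borel T) -> \bar R).
  apply/funext => B; have [mB|mB] := pselect (measurable B); first exact: munu.
  by rewrite mu0// nu0.
have eqmn : mu = nu.
  move: munu {mu0 nu0}; case: mu nu => [m cm] [n cn] /= mn.
  case: _ / mn in cn *; congr Probability.Pack.
  case: cm cn => [[a1 a2] [a3] [a4] [a5] [a6] [a7] [a8]].
  case=> [[b1 b2] [b3] [b4] [b5] [b6] [b7] [b8]].
  have ? := Prop_irrelevance a1 b1; have ? := Prop_irrelevance a2 b2; subst.
  have ? := Prop_irrelevance a3 b3; have ? := Prop_irrelevance a4 b4; subst.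
  have ? := Prop_irrelevance a5 b5; have ? := Prop_irrelevance a6 b6; subst.
  by have ? := Prop_irrelevance a7 b7; have ? := Prop_irrelevance a8 b8; subst.
by rewrite -{}eqmn in nu0 *; congr BorelProbability; exact: Prop_irrelevance.
Qed.

Section restriction.
Variable mu : probability (borel T) R.

Definition borel_restr (B : set (borel T)) : \bar R :=
  if `[< measurable B >] then mu B else 0%E.

Let borel_restr0 : borel_restr set0 = 0%E.
Proof. by rewrite /borel_restr; case: asboolP => // _; rewrite measure0. Qed.

Let borel_restr_ge0 B : (0 <= borel_restr B)%E.
Proof. by rewrite /borel_restr; case: asboolP. Qed.

Let borel_restrE B : measurable B -> borel_restr B = mu B.
Proof. by move=> mB; rewrite /borel_restr asboolT. Qed.

Let borel_restr_sigma_additive : semi_sigma_additive borel_restr.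
Proof.
move=> F mF tF mUF; rewrite borel_restrE//.
under eq_fun do under eq_bigr do rewrite borel_restrE//.
exact: measure_semi_sigma_additive.
Qed.

HB.instance Definition _ := isMeasure.Build _ _ _ borel_restr
  borel_restr0 borel_restr_ge0 borel_restr_sigma_additive.

Let borel_restr_setT : borel_restr setT = 1%E.
Proof. by rewrite borel_restrE// probability_setT. Qed.

HB.instance Definition _ :=
  Measure_isProbability.Build _ _ _ borel_restr borel_restr_setT.

Lemma borel_restr_nonmeasurable (B : set (borel T)) :
  ~ measurable B -> borel_restr B = 0%E.
Proof. by move=> mB; rewrite /borel_restr asboolF. Qed.

Definition to_borel_probability : borel_probability :=
  @BorelProbability borel_restr borel_restr_nonmeasurable.

End restriction.

HB.instance Definition _ :=
  isPointed.Build borel_probability (to_borel_probability (dirac point)).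

Record bounded_continuous := BoundedContinuous {
  bcfun :> T -> R ;
  bcfun_continuous : continuous bcfun ;
  bcfun_bounded : bounded_fun bcfun
}.

HB.instance Definition _ := gen_eqMixin bounded_continuous.
HB.instance Definition _ := gen_choiceMixin bounded_continuous.

Definition weak_eval (mu : borel_probability) : {ptws bounded_continuous -> R} :=
  fun f => \int[mu]_x f x.

(* The weak topology is the coarsest one for which every integration map      *)
(* mu |-> \int[mu]_x f x, with f bounded and continuous, is continuous.       *)
HB.instance Definition _ :=
  Topological.copy borel_probability (initial_topology weak_eval).

End borel_probability.

Section haar_null.
Context (R : realType).

Definition universally_measurable (T : ptopologicalType) (A : set T) : Prop :=
  forall mu : borel_probability R T, completed_algebra_gen mu A.

(* [S] is measurable for the completion of [mu], where it has value [c]. *)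
Definition completed_value (T : ptopologicalType) (mu : borel_probability R T)
    (S : set T) (c : \bar R) : Prop :=
  completed_algebra_gen mu S /\ @completed_measure_extension _ (borel T) R mu S = c.

Context (X : topologicalZmodType).

Definition translate_null (A : set X) : set (borel_probability R X) :=
  [set mu | forall x : X, completed_value mu [set x + a | a in A] 0%E].

Definition haar_null (A : set X) : Prop :=
  universally_measurable A /\ translate_null A !=set0.

End haar_null.

(* Main.v *)
Require Import Defs.
From HB Require Import structures.
From mathcomp Require Import all_boot all_order all_algebra.
From mathcomp Require Import all_classical all_reals all_analysis.
From mathcomp Require Import measurable_realfun.
From mathcomp Require Import ring.

Set Implicit Arguments.
Unset Strict Implicit.
Unset Printing Implicit Defensive.

Import Order.TTheory GRing.Theory Num.Theory.
Import numFieldNormedType.Exports.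
Local Open Scope classical_set_scope.
Local Open Scope ring_scope.

(** The set T(A) of test measures behaves like a face of the simplex P(X): a
    proper convex combination p mu + (1 - p) nu, 0 < p < 1, has as null sets
    exactly the common null sets of mu and nu, so it lies in T(A) if and only
    if both mu and nu do ([translate_null_mixture]). Consequently, for any two
    measures mu <> nu in T(A) and for every set B, the open segment between mu
    and nu is either contained in T(B) or disjoint from it. A continuous
    measure carried by such an open segment therefore satisfies the zero-one
    law for every B, and gives measure 1 to T(A). Here M is the image of the
    uniform law of [0, 1] by an injective continuous path in the open segment
    ([continuous_segment]); injectivity makes M continuous.

    Two points need work. First, T(B) is evaluated in the completion of M by
    comparison with the carrier E of M, so E must be Borel. As E is compact, it
    suffices that the weak topology of P(X) be Hausdorff
    ([borel_probability_hausdorff]), i.e. that bounded continuous functions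
    separate measures on a metrizable space ([bounded_continuous_separate]).

    Second, T(A) must contain two distinct measures
    ([distinct_translate_null]). It is stable under translation and under
    passing to a dominated measure. If mu in T(A) were its only element, mu
    would be invariant by translation, hence positive on nonempty open sets by
    separability; choosing a nonempty open set W disjoint from one of its
    translates, mu would be equal to its conditioning on W, so that W and its
    translate would both have measure 1. Such a W exists because X is Hausdorff
    and, not being locally compact, has a nonzero element. *)

(** * Values of the completion *)

Section completion.
Context (R : realType) (T : ptopologicalType) (mu : borel_probability R T).
Implicit Types (S : set T) (E : set (borel T)).

Let mu_extE E : measurable E -> (mu^*)%mu E = mu E.
Proof. exact: measurable_mu_extE. Qed.

Lemma completed_value0P S : completed_value mu S 0%E <-> mu.-negligible S.
Proof.
split=> [[[A mA [N negN <-{S}]] AN0]|[B [mB B0 SB]]].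
  apply: negligibleU => //; apply/negligibleP => //.
  apply/eqP; rewrite eq_le measure_ge0 andbT -AN0.
  by rewrite (le_trans _ (le_mu_ext mu (@subsetUl _ A N)))// mu_extE.
split.
  by exists set0 => //; exists S; [exists B|rewrite set0U].
apply/eqP; rewrite eq_le; apply/andP; split; last exact: mu_ext_ge0.
by rewrite -[leRHS]B0 (le_trans (le_mu_ext mu SB))// mu_extE.
Qed.

Lemma completed_value1 E S :
  measurable E -> mu E = 1%E -> E `<=` S -> completed_value mu S 1%E.
Proof.
move=> mE E1 ES; split.
  exists E => //; exists (S `\` E); last by rewrite setUDr setDv setD0 setUidr.
  exists (~` E); split; [exact: measurableC| |by move=> x []].
  by rewrite probability_setC// E1 subee.
apply/eqP; rewrite eq_le; apply/andP; split.
  rewrite -(probability_setT mu).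
  by rewrite (le_trans (le_mu_ext mu (@subsetT _ S)))// mu_extE.
by rewrite -E1 (le_trans _ (le_mu_ext mu ES))// mu_extE.
Qed.

End completion.

(** * The weak topology is Hausdorff *)

Section weak_topology.
Context (R : realType).

Lemma polish_hausdorff (T : topologicalType) : polish R T -> hausdorff_space T.
Proof.
move=> [_ [M [f [g [fK _ cf _ _]]]]] x y xy.
rewrite -(fK x) -(fK y); congr g; apply: (@metric_hausdorff _ M).
move=> A B /cf fA /cf fB.
by have [z [? ?]] := xy _ _ fA fB; exists (f z).
Qed.

(** The function is the distance to [F], brought into [0, 1] by [contract]. *)
Lemma closed_zero_set (T : topologicalType) (F : set T) : polish R T ->
  closed F -> exists h : T -> R,
    [/\ continuous h, forall x, 0 <= h x <= 1 & forall x, h x = 0 <-> F x].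
Proof.
move=> [_ [M [f [g [fK gK cf cg _]]]]] clF.
pose d (x : T) : \bar R := edist_inf (g @^-1` F) (f x).
exists (fun x => @contract R (d x)); split.
- have cc : continuous (@contract R).
    move=> x; apply/cvgrPdist_lt => e e0.
    exact: (@nbhsx_ballx _ (\bar R) x e e0).
  move=> x; apply: continuous_comp; last exact: cc.
  by apply: continuous_comp; [exact: cf|exact: edist_inf_continuous].
- move=> x /=; have := contract_le1 (d x); rewrite ler_norml => /andP[_ ->].
  rewrite andbT -(contract0 R) le_contract.
  exact: edist_inf_ge0.
- move=> x; split=> /= [/eqP|Fx].
    rewrite contract_eq0 => /eqP dx0.
    have clG : closed (g @^-1` F) by apply: preimage_closed => // y _; exact: cg.
    rewrite -(fK x); apply: clG => U /nbhs_ballP[e /= e0 eU].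
    have : (d x < e%:E)%E by rewrite dx0 lte_fin.
    move=> /ereal_inf_lt[_ [z Fz <-]] fze.
    by exists z; split => //; apply: eU; exact: (edist_lt_ball fze).
  by apply/eqP; rewrite contract_eq0 /d edist_inf0//= /preimage/= fK.
Qed.

Lemma continuous_measurable_borel (T : ptopologicalType) (h : T -> R) :
  continuous h -> measurable_fun [set: borel T] h.
Proof.
move=> /continuousP ch; apply: (measurability _ (RGenOpens.measurableE R)).
move=> _ [_ [a [b ->] <-]]; rewrite setTI; apply: sub_sigma_algebra.
exact/ch/interval_open.
Qed.

Lemma bounded_continuous_integrable (T : ptopologicalType)
    (mu : {finite_measure set (borel T) -> \bar R}) (h : bounded_continuous R T) :
  mu.-integrable setT (EFin \o h).
Proof.
apply: (@measurable_bounded_integrable _ (borel T)) => //.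
- exact: fin_num_fun_lty.
- by apply: continuous_measurable_borel; case: h.
- exact: bcfun_bounded.
Qed.

Lemma weak_eval_continuous (T : ptopologicalType) (h : bounded_continuous R T) :
  continuous (fun mu : borel_probability R T => \int[mu]_x h x).
Proof.
move=> mu; apply: (@continuous_comp _ {ptws bounded_continuous R T -> R} _
  (@weak_eval R T) (fun u => u h)); first exact: initial_continuous.
exact: proj_continuous.
Qed.

(** If [h] is continuous with values in [0, 1] and vanishes exactly on the
    closed set [F], then the powers of [1 - h] decrease to the indicator of
    [F]. So integrals of bounded continuous functions determine the measure of
    closed sets, hence of open sets, which form a generating pi-system. *)
Lemma bounded_continuous_separate (T : ptopologicalType)
    (mu nu : borel_probability R T) : polish R T ->
  (forall h : bounded_continuous R T, \int[mu]_x h x = \int[nu]_x h x) ->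
  mu = nu.
Proof.
move=> pT eqI; apply: borel_probability_ext => B mB.
have mC (F : set (borel T)) : closed (F : set T) -> measurable F.
  move=> cF; rewrite -(setCK F); apply: measurableC.
  by apply: sub_sigma_algebra; exact: closed_openC.
apply: (@measure_unique _ _ (borel T) (@open T) (fun=> setT)) => //.
- by move=> ? ?; exact: openI.
- by move=> _; exact: openT.
- by rewrite bigcup_const.
- move=> U oU; suff muC : mu (~` U) = nu (~` U).
    have mU : measurable (U : set (borel T)) by exact: sub_sigma_algebra.
    have mUC (m : borel_probability R T) : m U = (1 - m (~` U))%E.
      by rewrite -probability_setC ?setCK//; exact: measurableC.
    by transitivity (1 - mu (~` U))%E; [exact: mUC|rewrite muC; exact/esym/mUC].
  have cF := open_closedC oU; move: (~` U) cF => {U oU} F cF.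
  have mF := mC _ cF.
  have [h [ch h01 h0]] := closed_zero_set pT cF.
  have hb01 n x : 0 <= (1 - h x) ^+ n <= 1.
    have /andP[? ?] := h01 x.
    by apply/andP; split; [apply: exprn_ge0|apply: exprn_ile1];
      rewrite ?subr_ge0 ?gerBl.
  have bh n : bounded_fun (fun x => (1 - h x) ^+ n).
    exists 1; split => // M M1 x _; have /andP[? ?] := hb01 n x.
    by rewrite /= ger0_norm// (le_trans _ (ltW M1)).
  have cb n : continuous (fun x => (1 - h x) ^+ n).
    move=> x.
    apply: (@continuous_comp _ _ _ (fun x => 1 - h x) (fun r => r ^+ n)).
      by apply: cvgB; [exact: cvg_cst|exact: ch].
    exact: exprn_continuous.
  pose b n := BoundedContinuous (cb n) (bh n).
  have lim (m : borel_probability R T) :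
      (fun n => \int[m]_x (b n x)%:E)%E @ \oo --> m F.
    rewrite -[F]setIT -integral_indic//.
    have := @dominated_convergence _ (borel T) R m setT measurableT
      (fun n x => (b n x)%:E) (fun x => (\1_F x)%:E) (cst 1%E).
    case => //.
    - move=> n; apply/measurable_EFinP.
      by apply: continuous_measurable_borel; exact: cb.
    - by apply/measurable_EFinP; exact: measurable_indic.
    - apply: aeW => x _; apply: cvg_EFin; first exact: nearW.
      rewrite indicE; case: (pselect (F x)) => Fx.
        rewrite mem_set//; apply: cvg_near_cst; apply: nearW => n /=.
        by rewrite (h0 x).2// subr0 expr1n.
      rewrite memNset//; apply: cvg_expr.
      have /andP[hx0 hx1] := h01 x; rewrite ger0_norm ?subr_ge0// gtrBl.
      by rewrite lt_neqAle hx0 andbT; apply/eqP => /esym/h0.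
    - exact: (@finite_measure_integrable_cst _ (borel T) R m setT 1).
    - apply: aeW => x n _ /=; rewrite lee_fin.
      by have /andP[? ?] := hb01 n x; rewrite ger0_norm.
  have := lim nu; have <- : (fun n => \int[mu]_x (b n x)%:E)%E =
                            (fun n => \int[nu]_x (b n x)%:E)%E.
    have fin (m : borel_probability R T) n :
        (\int[m]_x (b n x)%:E)%E \is a fin_num.
      have bi := bounded_continuous_integrable m (b n).
      exact: (integrable_fin_num measurableT bi).
    apply/funext => n; rewrite -[LHS]fineK// -[RHS]fineK//; congr (_%:E).
    exact: eqI (b n).
  by move=> /(cvg_unique (@ereal_hausdorff R) (lim mu)).
- by move=> _; rewrite -ge0_fin_numE// fin_num_measure.
Qed.

Lemma borel_probability_hausdorff (T : ptopologicalType) : polish R T ->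
  hausdorff_space (borel_probability R T).
Proof.
move=> pT mu nu munu; apply: bounded_continuous_separate => // h.
apply: Rhausdorff => A B /weak_eval_continuous nA /weak_eval_continuous nB.
by have [m [? ?]] := munu _ _ nA nB; exists (\int[m]_x h x).
Qed.

End weak_topology.

(** * Image and conditional measures *)

Section image_measure.
Context (R : realType) d (S : measurableType d) (P : probability S R).
Context (T : ptopologicalType) (f : S -> borel T).
Hypothesis mf : measurable_fun setT f.

Let f_mixin := isMeasurableFun.Build _ _ _ _ f mf.
HB.instance Definition _ := f_mixin.

Lemma borel_image : exists nu : borel_probability R T,
  forall B : set (borel T), measurable B -> nu B = P (f @^-1` B).
Proof.
exists (to_borel_probability (distribution P f)) => B mB.
by rewrite /= /borel_restr asboolT.
Qed.

End image_measure.

Section conditioning.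
Context (R : realType) (T : ptopologicalType) (mu : borel_probability R T).

Lemma borel_conditional (U : set (borel T)) : measurable U -> mu U != 0%E ->
  exists nu : borel_probability R T, [/\ nu U = 1%E &
    forall B : set (borel T), measurable B -> mu B = 0%E -> nu B = 0%E].
Proof.
move=> mU U0.
have E (B : set (borel T)) : measurable B ->
   to_borel_probability (mnormalize (mrestr mu mU) mu) B =
   (mu (B `&` U) * (fine (mu U))^-1%:E)%E.
  move=> mB; rewrite /= /borel_restr asboolT//= /mnormalize /= /mrestr setTI.
  rewrite (negbTE U0)/= ifF//.
  by apply/negbTE; rewrite -ltey -ge0_fin_numE// fin_num_measure.
exists (to_borel_probability (mnormalize (mrestr mu mU) mu)); split.
  rewrite E// setIid -[X in (X * _)%E]fineK ?fin_num_measure//.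
  by rewrite -EFinM divff// fine_eq0// fin_num_measure.
move=> B mB B0; rewrite E// (_ : mu (B `&` U) = 0%E) ?mul0e//.
apply/eqP; rewrite -measure_le0 -B0.
by apply: le_measure; rewrite ?inE//; exact: measurableI.
Qed.

End conditioning.

(** * Stability of the set of test measures *)

Section test_measures.
Context (R : realType) (X : topologicalZmodType).
Implicit Types (A : set X) (mu nu : borel_probability R X).

Lemma translate_nullP A mu :
  translate_null A mu <-> forall x, mu.-negligible [set x + a | a in A].
Proof. by split=> TA x; apply/completed_value0P/TA. Qed.

Lemma translate_null_dominated A mu nu :
  (forall B : set (borel X), measurable B -> mu B = 0%E -> nu B = 0%E) ->
  translate_null A mu -> translate_null A nu.
Proof.
move=> numu /translate_nullP TA; apply/translate_nullP => x.
by have [B [mB B0 AB]] := TA x; exists B; split => //; exact: numu.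
Qed.

Lemma addl_continuous (x : X) : continuous (fun y : X => x + y).
Proof.
move=> y; apply: (@continuous_comp _ _ _ (fun y => (x, y))
  (fun z : X * X => z.1 + z.2)); last exact: add_continuous.
by apply: cvg_pair; [exact: cvg_cst|exact: cvg_id].
Qed.

Lemma addl_measurable (x : X) :
  measurable_fun [set: borel X] ((fun y => x + y) : borel X -> borel X).
Proof.
apply: (@measurability _ _ (borel X) (borel X) _ _ (@open X)) => //.
move=> _ [U oU <-]; rewrite setTI; apply: sub_sigma_algebra.
by move/continuousP: (@addl_continuous x); exact.
Qed.

Lemma addl_preimage_measurable (x : X) (B : set (borel X)) :
  measurable B -> measurable ((fun y => x + y) @^-1` B : set (borel X)).
Proof.
by move=> mB; rewrite -[X in measurable X]setTI; exact: addl_measurable.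
Qed.

Lemma translate_null_translate A mu (x : X) : translate_null A mu ->
  exists nu, translate_null A nu /\ forall B : set (borel X), measurable B ->
    nu B = mu ((fun y => x + y) @^-1` B).
Proof.
have [nu nuE] := borel_image mu (addl_measurable x).
move=> /translate_nullP TA; exists nu; split => //.
apply/translate_nullP => y; have [N [mN N0 AN]] := TA (y - x).
exists ((fun z => - x + z) @^-1` N); split.
- exact: addl_preimage_measurable.
- rewrite nuE; last exact: addl_preimage_measurable.
  by rewrite -N0; congr (mu _); apply/seteqP; split=> z /=; rewrite addKr.
- by move=> _ [a Aa <-]; apply: AN; exists a => //; rewrite addrCA addrA.
Qed.

Lemma not_locally_compact_neq0 : ~ locally_compact [set: X] ->
  exists p : X, p != 0.
Proof.
move=> nlc; apply: contrapT => np; apply: nlc => x _.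
exists setT; first exact: filterT.
split; last exact: closedT.
rewrite (_ : setT = [set 0]); first exact: compact_set1.
apply/seteqP; split=> // y _ /=; apply: contrapT => y0.
by apply: np; exists y; exact/eqP.
Qed.

(** If [mu] were the only test measure, it would be equal to all its translates
    and to its conditioning on any open set [W] that it charges. This is
    contradictory as soon as [W] is disjoint from one of its translates. *)
Lemma distinct_translate_null A mu : polish R X ->
  (exists p : X, p != 0) -> translate_null A mu ->
  exists2 nu, translate_null A nu & nu != mu.
Proof.
move=> pX [p p0] TA; apply: contrapT => uniq.
have {}uniq nu : translate_null A nu -> nu = mu.
  by move=> TAnu; apply: contrapT => /eqP nm; apply: uniq; exists nu.
have inv x (B : set (borel X)) : measurable B ->
    mu ((fun y => x + y) @^-1` B) = mu B.
  have [nu [/uniq -> nuE]] := translate_null_translate x TA.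
  by move=> mB; rewrite -nuE.
have := polish_hausdorff pX; rewrite open_hausdorff => /(_ _ _ p0).
move=> [[U V] /= [Up V0] [oU oV /eqP UV]].
rewrite !inE in Up V0.
pose W : set (borel X) := V `&` ((fun y => p + y) @^-1` U).
have oW : open (W : set X).
  by apply: openI => //; move/continuousP: (@addl_continuous p); exact.
have mW : measurable W by exact: sub_sigma_algebra.
have W0 : W 0 by split => //=; rewrite addr0.
(* Otherwise countably many translates of the null set [W] would cover [X]. *)
have muW0 : mu W != 0%E.
  apply/eqP => muW0; have [[D cD dD] _] := pX.
  have /negligibleP : mu.-negligible (setT : set (borel X)).
    have /pcard_surjP[f Df] := cD.
    suff XW : setT `<=` \bigcup_k ((fun y => - f k + y) @^-1` W).
      apply: (@negligibleS _ (borel X) R mu _ _ XW); apply: negligible_bigcup => k.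
      apply/negligibleP; first exact: addl_preimage_measurable.
      by rewrite -muW0; exact: inv.
    move=> x _.
      have [||d [/= Wd Dd]] := dD ((fun y => x - y) @^-1` W).
      - by exists x; rewrite /preimage/= subrr.
      - have cW : continuous (fun y : X => x - y).
          move=> y; apply: (@continuous_comp _ _ _ -%R (fun z : X => x + z)).
            exact: opp_continuous.
          exact: addl_continuous.
        by move/continuousP: cW; exact.
      - by have [k _ fk] := Df d Dd; exists k => //=; rewrite fk addrC.
  move=> /(_ measurableT) muT0.
  have : 0%E = 1%E :> \bar R by rewrite -[LHS]muT0; exact: probability_setT.
  by move=> /eqP; rewrite eq_sym onee_eq0.
have [nu [nuW numu]] := borel_conditional mW muW0.
have muW1 : mu W = 1%E.
  by rewrite -(uniq nu)//; exact: translate_null_dominated TA.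
have : mu ((fun y => - p + y) @^-1` W) = 0%E.
  apply/eqP; rewrite -measure_le0.
  have <- : mu (~` W) = 0%E by rewrite probability_setC// muW1 subee.
  apply: le_measure; rewrite ?inE.
  - exact: addl_preimage_measurable.
  - exact: measurableC.
  - move=> y [_ /= +] [+ _]; rewrite addrA subrr add0r => Uy Vy.
    by have : set0 y by rewrite -UV.
by rewrite inv// muW1 => /eqP; rewrite onee_eq0.
Qed.

End test_measures.

(** * Segments of measures *)

Section mixture.
Context (R : realType) (T : ptopologicalType).
Implicit Types (mu nu m : borel_probability R T) (p : R).

Definition mixture mu nu p m := forall B : set (borel T), measurable B ->
  m B = (p%:E * mu B + (1 - p)%:E * nu B)%E.

Lemma mixture_exists mu nu p : 0 < p < 1 -> exists m, mixture mu nu p m.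
Proof.
move=> /andP[p0 p1]; have q0 : 0 <= 1 - p by rewrite subr_ge0 ltW.
pose s : {measure set (borel T) -> \bar R} :=
  measure_add (mscale (NngNum (ltW p0)) mu) (mscale (NngNum q0) nu).
have sE (B : set (borel T)) : s B = (p%:E * mu B + (1 - p)%:E * nu B)%E.
  exact: measure_addE.
exists (to_borel_probability (mnormalize s mu)) => B mB.
have sT : s setT = 1%E.
  by rewrite sE !probability_setT !mule1 -EFinD addrC subrK.
(* [s] has total mass 1: normalizing it only provides the structure of a
   probability. *)
rewrite /= /borel_restr asboolT//= /mnormalize /= sT/= onee_eq0/=.
by rewrite invr1 mule1 sE.
Qed.

Lemma mixture_Rintegral mu nu p m (h : bounded_continuous R T) :
  0 < p < 1 -> mixture mu nu p m ->
  \int[m]_x h x = p * \int[mu]_x h x + (1 - p) * \int[nu]_x h x.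
Proof.
move=> /andP[p0 p1] mE; have q0 : 0 <= 1 - p by rewrite subr_ge0 ltW.
have mh : measurable_fun [set: borel T] (EFin \o h).
  apply/measurable_EFinP; apply: continuous_measurable_borel.
  exact: bcfun_continuous.
have pos (f : borel T -> \bar R) :
    measurable_fun setT f -> (forall x, 0 <= f x)%E ->
    (\int[m]_x f x = p%:E * \int[mu]_x f x + (1 - p)%:E * \int[nu]_x f x)%E.
  move=> mf f0.
  pose s := measure_add (mscale (NngNum (ltW p0)) mu) (mscale (NngNum q0) nu).
  rewrite (@eq_measure_integral _ (borel T) R setT s); last first.
    by move=> B mB _; rewrite [LHS](mE B mB); exact/esym/measure_addE.
  by rewrite ge0_integral_measure_add// !ge0_integral_mscale.
have fin (k : borel_probability R T) (f : borel T -> \bar R) :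
    k.-integrable setT f -> (\int[k]_x f x)%E \is a fin_num.
  exact: integrable_fin_num.
have ih (k : borel_probability R T) := bounded_continuous_integrable k h.
rewrite /Rintegral; set I := (\int[m]_x _)%E.
suff -> : I = (p%:E * \int[mu]_x (h x)%:E + (1 - p)%:E * \int[nu]_x (h x)%:E)%E.
  rewrite fineD ?fin_numM ?fin//; [|exact: ih|exact: ih].
  by rewrite !fineM ?fin//; [exact: ih|exact: ih].
have IE (k : borel_probability R T) : (\int[k]_x (h x)%:E =
    \int[k]_x (EFin \o h)^\+ x - \int[k]_x (EFin \o h)^\- x)%E.
  exact: integralE.
rewrite {}/I !IE.
rewrite !pos; [|exact: measurable_funeneg|by []|exact: measurable_funepos|by []].
have ep (k : borel_probability R T) :=
  fin k _ (integrable_funepos measurableT (ih k)).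
have en (k : borel_probability R T) :=
  fin k _ (integrable_funeneg measurableT (ih k)).
rewrite -(fineK (ep mu)) -(fineK (en mu)) -(fineK (ep nu)) -(fineK (en nu)).
rewrite -!(EFinM, EFinD, EFinN); congr EFin.
ring.
Qed.

End mixture.

Section logistic.
Context (R : realType).

(** Any continuous injection of the line into ]0, 1[ would do as a family of
    weights: it keeps the endpoints out of the parametrized segment. *)
Definition logistic (t : R) : R := (1 + expR t)^-1.

Let den_gt1 (t : R) : 1 < 1 + expR t.
Proof. by rewrite ltrDl expR_gt0. Qed.

Lemma logistic_itv t : 0 < logistic t < 1.
Proof.
by rewrite invr_gt0 invf_lt1 ?den_gt1 ?(lt_trans ltr01 (den_gt1 t)).
Qed.

Lemma logistic_inj : injective logistic.
Proof. by move=> s t /invr_inj/addrI/expR_inj. Qed.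

Lemma logistic_continuous : continuous logistic.
Proof.
move=> t; apply: cvgV; first by rewrite gt_eqF// (lt_trans ltr01 (den_gt1 t)).
by apply: cvgD; [exact: cvg_cst|exact: continuous_expR].
Qed.

End logistic.

Section segment.
Context (R : realType) (T : ptopologicalType) (mu nu : borel_probability R T).

Lemma continuous_segment : mu != nu ->
  exists phi : R -> borel_probability R T,
  [/\ continuous phi, injective phi &
      forall t, mixture mu nu (logistic t) (phi t)].
Proof.
move=> munu.
have [phi phiE] := choice (fun t => mixture_exists mu nu (logistic_itv t)).
exists phi; split => //.
  apply: continuous_comp_initial => t; apply/cvg_sup => h.
  apply: (@continuous_comp_initial _ _ _
    (fun u : {ptws bounded_continuous R T -> R} => u h) (@weak_eval R T \o phi)).
  have -> : (fun u : {ptws bounded_continuous R T -> R} => u h) \o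
        (@weak_eval R T \o phi) =
      (fun s => logistic s * \int[mu]_x h x + (1 - logistic s) * \int[nu]_x h x).
    by apply/funext => s; apply: mixture_Rintegral; [exact: logistic_itv|].
  move=> s; apply: cvgD; apply: cvgMl; first exact: logistic_continuous.
  by apply: cvgB; [exact: cvg_cst|exact: logistic_continuous].
(* A Borel set on which [mu] and [nu] differ recovers the weight. *)
have [B mB muB] : exists2 B : set (borel T), measurable B & mu B != nu B.
  apply: contrapT => nB; move/eqP: munu; apply; apply: borel_probability_ext.
  by move=> B mB; apply: contrapT => /eqP ?; apply: nB; exists B.
move=> s t st; apply: logistic_inj.
have := phiE s B mB; rewrite st (phiE t B mB).
move: muB; rewrite -(@fineK _ (mu B)) ?fin_num_measure//.
rewrite -(@fineK _ (nu B)) ?fin_num_measure// -!EFinM -!EFinD eqe.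
move: (fine (mu B)) (fine (nu B)) => a b ab [E].
have /eqP : (logistic t - logistic s) * (a - b) = 0.
  move/eqP: E; rewrite -subr_eq0 => /eqP <-; ring.
by rewrite mulf_eq0 !subr_eq0 (negbTE ab) orbF => /eqP ->.
Qed.

End segment.

(** * The zero-one law *)

(** A proper mixture dominates both of its components, and a set that is
    negligible for both is negligible for the mixture. *)
Lemma translate_null_mixture (R : realType) (X : topologicalZmodType) (A : set X)
    (mu nu m : borel_probability R X) (p : R) : 0 < p < 1 -> mixture mu nu p m ->
  translate_null A m <-> translate_null A mu /\ translate_null A nu.
Proof.
move=> /andP[p0 p1] mE; split=> [TA|[/translate_nullP TAmu /translate_nullP TAnu]].
  have null (B : set (borel X)) : measurable B -> m B = 0%E ->
      mu B = 0%E /\ nu B = 0%E.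
    move=> mB; rewrite (mE B mB) => B0.
    have : (p%:E * mu B == 0)%E && ((1 - p)%:E * nu B == 0)%E.
      rewrite -padde_eq0; first exact/eqP.
        by rewrite mule_ge0// lee_fin ltW.
      by rewrite mule_ge0// lee_fin subr_ge0 ltW.
    rewrite !mule_eq0 !eqe subr_eq0 (gt_eqF p0) (gt_eqF p1)/=.
    by move=> /andP[/eqP ? /eqP ?].
  by split; apply: translate_null_dominated TA => B mB /(null B mB)[].
apply/translate_nullP => x.
have [B [mB B0 AB]] := TAmu x; have [C [mC C0 AC]] := TAnu x.
exists (B `&` C); split; [exact: measurableI| |]; last first.
  by move=> y Ay; split; [exact: AB|exact: AC].
have null (k : borel_probability R X) (D E : set (borel X)) :
    measurable D -> measurable E -> D `<=` E -> k E = 0%E -> k D = 0%E.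
  by move=> mD mE' DE E0; apply/eqP; rewrite -measure_le0 -E0 le_measure ?inE.
have mBC : measurable (B `&` C) by exact: measurableI.
rewrite (mE _ mBC).
have -> : mu (B `&` C) = 0%E by apply: null B0 => // y [].
have -> : nu (B `&` C) = 0%E by apply: null C0 => // y [].
by rewrite !mule0 adde0.
Qed.

Theorem corollary16 (R : realType) (X : topologicalZmodType)
    (polishX : polish R X) (nlcX : ~ locally_compact [set: X])
    (A : set X) (analyticA : analytic R A) (nullA : haar_null R A) :
  exists M : borel_probability R (borel_probability R X),
    [/\ (forall mu : borel_probability R X, M [set mu] = 0%E),
        completed_value M (translate_null A) 1%E
      & forall B : set X, analytic R B -> haar_null R B ->
          completed_value M (translate_null B) 1%E \/
          completed_value M (translate_null B) 0%E].
Proof.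
have [_ [mu TAmu]] := nullA.
have [nu TAnu numu] := distinct_translate_null polishX
  (not_locally_compact_neq0 nlcX) TAmu.
have [phi [cphi iphi phiE]] := continuous_segment numu.
have mphi : measurable_fun [set: R] (phi : R -> borel (borel_probability R X)).
  apply: (@measurability _ _ _ (borel (borel_probability R X)) _ _ (@open _)).
    by [].
  move=> _ [U oU <-]; rewrite setTI; apply: open_measurable.
  by move/continuousP: cphi; exact.
pose U01 := uniform_prob (@ltr01 R).
have U0 t : U01 [set t] = 0%E.
  have /null_content_dominatesP dom := dominates_uniform_prob (@ltr01 R).
  apply: (dom [set t] (measurable_set1 t)).
  exact: lebesgue_measure_set1.
have [M ME] := borel_image U01 mphi.
pose E : set (borel (borel_probability R X)) := phi @` `[0, 1].
have mE : measurable E.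
  rewrite -(setCK E); apply: measurableC; apply: sub_sigma_algebra.
  apply: closed_openC; apply: compact_closed.
    exact: borel_probability_hausdorff.
  apply: continuous_compact; last exact: segment_compact.
  exact: continuous_subspaceT.
have E1 : M E = 1%E.
  rewrite ME//; apply: integral_uniform_pdf1 => //.
  by move=> t t01; exists t.
have TP B t :
    translate_null B (phi t) <-> translate_null B nu /\ translate_null B mu.
  exact: translate_null_mixture (logistic_itv t) (phiE t).
have T1 B : translate_null B nu -> translate_null B mu ->
    completed_value M (translate_null B) 1%E.
  move=> Tnu Tmu; apply: (completed_value1 mE E1) => _ [t _ <-].
  exact/TP.
exists M; split.
- move=> m.
  have [mm|/bprob_nonmeasurable//] :=
    pselect (measurable ([set m] : set (borel _))).
  have [[t _ tm]|nt] := pselect (range phi m); last first.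
    rewrite ME// (_ : _ @^-1` _ = set0) ?measure0//.
    by apply/seteqP; split=> // s /= sm; apply: nt; exists s.
  rewrite ME// (_ : _ @^-1` _ = [set t]).
    exact: U0.
  by apply/seteqP; split=> s /= => [sm|->//]; apply: iphi; rewrite sm tm.
- exact: T1.
- move=> B _ _; have [[Tnu Tmu]|nT] :=
    pselect (translate_null B nu /\ translate_null B mu); first by left; exact: T1.
  right; apply/completed_value0P; exists (~` E); split.
  + exact: measurableC.
  + by rewrite probability_setC// E1 subee.
  + by move=> m TBm [t _ tm]; apply: nT; apply/(TP B t); rewrite tm.
Qed.
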